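(* If $m$ is a non-negative integer, then \[ \begin{aligned} \sum_{n=1}^\infty\frac{2^{2n}O_{n+m}}{n(n+1)(n+2)\binom{2(n+m)}{n+m}\binom{n+m}{m}} &=\frac{1}{2\binom{2m}{m}}\left(m-O_m\left(m-\frac12\right)\left(m+\frac12\right)\right)\left(3\zeta(2)-4O_m^{(2)}\right)\\ &\quad-\frac{1}{2\binom{2m}{m}}\left(\left(m-\frac12\right)\left(m+\frac12\right)\left(7\zeta(3)-8O_m^{(3)}\right)-mO_m+\frac12\right). \end{aligned} \] In particular, \[ \sum_{n=1}^\infty\frac{2^{2n}O_n}{n(n+1)(n+2)\binom{2n}{n}}=\frac78\zeta(3)-\frac14,\qquad \sum_{n=1}^\infty\frac{2^{2n}O_{n+1}}{n(n+1)^2(n+2)\binom{2(n+1)}{n+1}}=\frac{\pi^2}{32}-\frac{21}{16}\zeta(3)+\frac{11}{8}. \]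
   Context: $\zeta$ is the Riemann zeta function. For nonnegative integer $m$ and positive integer $r$, $O_m^{(r)}=\sum_{j=1}^m(2j-1)^{-r}$ (empty sum $=0$), $O_m=O_m^{(1)}$. *)

(* Defs.v *)
(* Stdlib's real numbers with Coquelicot. *)
From Stdlib Require Export Reals.
From Coquelicot Require Export Coquelicot.
Open Scope R_scope.

(* The Riemann zeta function as a Dirichlet series at a real argument. [Series]
   is total, so the definition is meaningful only for [1 < s]. *)
Definition zeta (s : R) : R := Series (fun k : nat => / Rpower (INR (S k)) s).

(* [sum_n_m a 1 m] is the sum of [a j] over [1 <= j <= m], and [0] if [m = 0]. *)
Definition odd_harmonic (r m : nat) : R :=
  sum_n_m (fun j : nat => / (2 * INR j - 1) ^ r) 1 m.

(* Coquelicot's [C] is the type of complex numbers; it shadows the real-valued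
   binomial coefficient of the standard library. *)
Definition binom (n k : nat) : R := Binomial.C n k.

(* [is_series] indexes from 0; this is the same predicate for a series whose
   index starts at 1: the series converges and its sum is [l]. *)
Definition is_series_from_1 (a : nat -> R) (l : R) : Prop :=
  is_series (fun k : nat => a (S k)) l.

(* Main.v *)
(* Put x = m + 1/2, V_k = k!/(x(x+1)...(x+k)) and H_k = 1/x + ... + 1/(x+k), so
   that H is minus the logarithmic derivative of V in x. With n = k + 1 the summand
   is V_k (O_m + H_k/2) / ((k+2)(k+3)), up to the factor 1/binom(2m,m). Up to a
   telescoping term, V_k/((k+2)(k+3)) is a multiple of V_k/(k+1), and
   sum V_k/(k+1) = sum 1/(x+j)^2, because replacing x by x+1 changes the left side
   by a telescoping series with sum 1/x^2. Differentiating these identities term by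
   term in x gives the sums weighted by H_k, with 2/(x+j)^3 in place of 1/(x+j)^2.
   At x = m + 1/2 the resulting sums are odd-denominator zeta tails.
   The value zeta(2) = pi^2/6 needed for m = 1 comes from
   sum_(k<N) 1/sin^2((2k+1)pi/(4N)) = 2N^2 for N = 2^n, and
   1/sin^2 t - 1 < 1/t^2 < 1/sin^2 t. *)
Require Import Defs.
From Stdlib Require Import Reals Factorial Lra Lia.
From Coquelicot Require Import Coquelicot.
Open Scope R_scope.

(** * Partial sums, telescoping series and shift recursions *)

Fixpoint psum (a : nat -> R) (N : nat) : R :=
  match N with
  | O => 0
  | S N => psum a N + a N
  end.

Lemma psum_ext (a b : nat -> R) (N : nat) :
  (forall k, (k < N)%nat -> a k = b k) -> psum a N = psum b N.
Proof.
  induction N as [|N IH]; intros H; simpl; [reflexivity|].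
  rewrite IH, H; auto with arith.
Qed.

Lemma psum_le (a b : nat -> R) (N : nat) :
  (forall k, (k < N)%nat -> a k <= b k) -> psum a N <= psum b N.
Proof.
  induction N as [|N IH]; intros H; simpl; [lra|].
  apply Rplus_le_compat; auto with arith.
Qed.

Lemma psum_plus (a b : nat -> R) (N : nat) :
  psum (fun k => a k + b k) N = psum a N + psum b N.
Proof. induction N as [|N IH]; simpl; [lra|rewrite IH; ring]. Qed.

Lemma psum_scal (c : R) (a : nat -> R) (N : nat) :
  psum (fun k => c * a k) N = c * psum a N.
Proof. induction N as [|N IH]; simpl; [lra|rewrite IH; ring]. Qed.

Lemma psum_const (c : R) (N : nat) : psum (fun _ => c) N = INR N * c.
Proof. induction N as [|N IH]; [simpl; lra|rewrite S_INR; simpl; rewrite IH; ring]. Qed.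

Lemma psum_telescope (b : nat -> R) (N : nat) :
  psum (fun k => b k - b (S k)) N = b 0%nat - b N.
Proof. induction N as [|N IH]; simpl; [lra|rewrite IH; ring]. Qed.

Lemma psum_app (a : nat -> R) (M N : nat) :
  psum a (M + N) = psum a M + psum (fun k => a (M + k)%nat) N.
Proof.
  induction N as [|N IH]; simpl.
  - rewrite Nat.add_0_r; lra.
  - rewrite Nat.add_succ_r; simpl; rewrite IH; ring.
Qed.

Lemma psum_rev (a : nat -> R) (N : nat) :
  psum (fun k => a (N - 1 - k)%nat) N = psum a N.
Proof.
  revert a; induction N as [|N IH]; intros a; simpl; [reflexivity|].
  change (psum a N + a N) with (psum a (1 + N)).
  rewrite psum_app; simpl.
  rewrite <- (IH (fun k => a (S k))).
  replace (N - 0 - N)%nat with 0%nat by lia.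
  rewrite Rplus_comm; f_equal; [ring|].
  apply psum_ext; intros k Hk; f_equal; lia.
Qed.

Lemma psum_even_odd (a : nat -> R) (N : nat) :
  psum a (2 * N) =
  psum (fun k => a (2 * k)%nat) N + psum (fun k => a (S (2 * k))) N.
Proof.
  induction N as [|N IH]; [simpl; lra|].
  replace (2 * S N)%nat with (S (S (2 * N))) by lia.
  cbn [psum]; rewrite IH; ring.
Qed.

Lemma psum_sum_n (a : nat -> R) (N : nat) : psum a (S N) = sum_n a N.
Proof.
  induction N as [|N IH].
  - rewrite sum_O; simpl; lra.
  - rewrite sum_Sn, <- IH; reflexivity.
Qed.

(** [sum_n a N] has [N + 1] terms while [psum a N] has [N], hence the shift by one; the limit is the
    same. *)
Lemma is_series_psum (a : nat -> R) (l : R) :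
  is_series a l <-> is_lim_seq (psum a) l.
Proof.
  rewrite (is_lim_seq_incr_1 (psum a)).
  split; intros H.
  - apply is_lim_seq_ext with (sum_n a); [intros n; symmetry; apply psum_sum_n|exact H].
  - assert (H' : is_lim_seq (sum_n a) l); [|exact H'].
    apply is_lim_seq_ext with (2 := H); intros n; apply psum_sum_n.
Qed.

(** The partial sums of [a] and [b] differ by [D 0 - D N]. Every identity between series below is
    proved by exhibiting such a [D]. *)
Lemma is_series_diff (a b D : nat -> R) (l : R) :
  (forall k, a k = b k + (D k - D (S k))) -> is_lim_seq D 0 ->
  is_series b l -> is_series a (l + D 0%nat).
Proof.
  intros Ha HD Hb. apply is_series_psum. apply is_series_psum in Hb.
  apply is_lim_seq_ext with (fun N => psum b N + (D 0%nat - D N)).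
  - intros N. rewrite <- psum_telescope, <- psum_plus. apply psum_ext; auto.
  - replace (l + D 0%nat) with (l + (D 0%nat - 0)) by ring.
    apply is_lim_seq_plus'; [exact Hb|].
    apply is_lim_seq_minus'; [apply is_lim_seq_const|exact HD].
Qed.

Lemma is_lim_seq_inv_shift (c : R) : is_lim_seq (fun n => / (INR n + c)) 0.
Proof.
  apply (is_lim_seq_inv (fun n => INR n + c) p_infty); [|easy].
  apply is_lim_seq_plus with p_infty c;
    [apply is_lim_seq_INR|apply is_lim_seq_const|reflexivity].
Qed.

(** The dominating series telescopes to exactly [c], so comparison gives convergence together with
    an explicit bound on the sum. *)
Lemma is_series_dominated_telescope (a : nat -> R) (c : R) :
  (forall k, 0 <= a k <= c * (/ (INR k + 1) - / (INR (S k) + 1))) ->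
  exists l : R, is_series a l /\ 0 <= l <= c.
Proof.
  intros Ha.
  assert (Hb : is_series (fun k => c * (/ (INR k + 1) - / (INR (S k) + 1))) c).
  { apply is_series_psum.
    apply is_lim_seq_ext with (fun N => c * (1 - / (INR N + 1))).
    - intros N. rewrite psum_scal, (psum_telescope (fun k => / (INR k + 1))).
      simpl; f_equal; f_equal; field.
    - replace (Finite c) with (Finite (c * (1 - 0))) by (f_equal; ring).
      apply is_lim_seq_mult'; [apply is_lim_seq_const|].
      apply is_lim_seq_minus'; [apply is_lim_seq_const|apply is_lim_seq_inv_shift]. }
  assert (He : ex_series a).
  { apply (ex_series_le (V := R_CompleteNormedModule) a (fun k => c * (/ (INR k + 1) - / (INR (S k) + 1)))).
    - intros k. change (Rabs (a k) <= c * (/ (INR k + 1) - / (INR (S k) + 1))).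
      rewrite Rabs_pos_eq; apply Ha.
    - exists c; exact Hb. }
  destruct He as [l Hl]. exists l; split; [exact Hl|].
  pose proof Hl as Hl'.
  apply is_series_psum in Hl. apply is_series_psum in Hb.
  split.
  - apply (is_lim_seq_le (fun _ => 0) (psum a) 0 l); [|apply is_lim_seq_const|exact Hl].
    intros N. replace 0 with (psum (fun _ => 0) N) by (rewrite psum_const; ring).
    apply psum_le; intros; apply Ha.
  - apply (is_lim_seq_le _ _ l c) with (2 := Hl) (3 := Hb).
    intros N; apply psum_le; intros; apply Ha.
Qed.

(* Iterating the recursion from [x] to [x + M] leaves the tail [a (x + M)],
   whose sum is at most [2 / (x + M)]. *)
Lemma is_series_shift_recursion (a D : R -> nat -> R) (x : R) :
  1 / 2 <= x ->
  (forall y k, 1 / 2 <= y -> a y k = a (y + 1) k + (D y k - D y (S k))) ->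
  (forall y, 1 / 2 <= y -> is_lim_seq (D y) 0) ->
  (forall y k, 3 <= y ->
     0 <= a y k <= 2 / y * (/ (INR k + 1) - / (INR (S k) + 1))) ->
  exists l : R, is_series (a x) l /\ is_series (fun j => D (x + INR j) 0%nat) l.
Proof.
  intros Hx Hrec HD Hb.
  assert (Hup : forall M l, is_series (a (x + INR M)) l ->
            is_series (a x) (l + psum (fun j => D (x + INR j) 0%nat) M)).
  { induction M as [|M IH]; intros l Hl.
    - simpl in *. rewrite Rplus_0_r in Hl |- *. exact Hl.
    - pose proof (pos_INR M) as HM.
      replace (l + _) with
        ((l + D (x + INR M) 0%nat) + psum (fun j => D (x + INR j) 0%nat) M)
        by (simpl; ring).
      apply IH. rewrite S_INR, <- Rplus_assoc in Hl.
      apply is_series_diff with (3 := Hl).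
      + intros k; apply Hrec; lra.
      + apply HD; lra. }
  assert (Htail : forall M, 3 <= x + INR M ->
            exists l : R, is_series (a (x + INR M)) l /\ 0 <= l <= 2 / (x + INR M)).
  { intros M HM. apply is_series_dominated_telescope.
    intros k; apply Hb; exact HM. }
  assert (Hex : exists l : R, is_series (a x) l).
  { destruct (Htail 3%nat) as [l [Hl _]]; [simpl; lra|].
    eexists; apply Hup; exact Hl. }
  destruct Hex as [L HL]. exists L; split; [exact HL|].
  apply is_series_psum.
  (* By [Hup], the sum of the first [M] values of [D] is [L] minus a tail lying between 0 and
     [2 / (x + M)], so it is squeezed to [L]. *)
  apply is_lim_seq_le_le_loc with (fun M => L - 2 * / (INR M + x)) (fun _ => L).
  - exists 3%nat. intros M HM. apply le_INR in HM. simpl in HM.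
    destruct (Htail M) as [l [Hl Hl']]; [lra|].
    apply Hup in Hl. apply is_series_unique in Hl. apply is_series_unique in HL.
    rewrite HL in Hl. rewrite (Rplus_comm (INR M)). unfold Rdiv in Hl'. lra.
  - replace (Finite L) with (Finite (L - 2 * 0)) by (f_equal; ring).
    apply is_lim_seq_minus'; [apply is_lim_seq_const|].
    apply is_lim_seq_mult'; [apply is_lim_seq_const|apply is_lim_seq_inv_shift].
  - apply is_lim_seq_const.
Qed.

(** * Shifts, bounds and limits of [V] and [H] *)

(* [V x k = k! / (x (x+1) ... (x+k))]; its logarithmic derivative in [x] is [- H x k]. *)
Fixpoint V (x : R) (k : nat) : R :=
  match k with
  | O => / x
  | S k => V x k * (INR (S k) / (x + INR (S k)))
  end.

Fixpoint H (x : R) (k : nat) : R :=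
  match k with
  | O => / x
  | S k => H x k + / (x + INR (S k))
  end.

Lemma V_pos (x : R) (k : nat) : 0 < x -> 0 < V x k.
Proof.
  intros Hx; induction k as [|k IH]; cbn [V].
  - now apply Rinv_0_lt_compat.
  - pose proof (pos_INR k). rewrite S_INR.
    apply Rmult_lt_0_compat; [exact IH|apply Rdiv_lt_0_compat; lra].
Qed.

Lemma H_pos (x : R) (k : nat) : 0 < x -> 0 < H x k.
Proof.
  intros Hx; induction k as [|k IH]; cbn [H].
  - now apply Rinv_0_lt_compat.
  - pose proof (pos_INR (S k)).
    apply Rplus_lt_0_compat; [exact IH|apply Rinv_0_lt_compat; lra].
Qed.

Lemma V_step (x : R) (k : nat) : 0 < x ->
  V x k - V x (S k) = V x k * (x / (x + INR k + 1)).
Proof.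
  intros Hx; pose proof (pos_INR k); cbn [V]; rewrite S_INR; field; lra.
Qed.

(** The denominator loses the factor [x] and gains [x + k + 1]. Together with [V_step] this says
    [V x k - V x (S k) = V (x + 1) k]. *)
Lemma V_shift (x : R) (k : nat) : 0 < x ->
  V (x + 1) k = V x k * (x / (x + INR k + 1)).
Proof.
  intros Hx; induction k as [|k IH]; [simpl; field; lra|].
  pose proof (pos_INR k). cbn [V]; rewrite IH, !S_INR. field; lra.
Qed.

Lemma H_shift (x : R) (k : nat) : 0 < x ->
  H (x + 1) k = H x k + / (x + INR k + 1) - / x.
Proof.
  intros Hx; induction k as [|k IH]; [simpl; field; lra|].
  pose proof (pos_INR k). cbn [H]; rewrite IH, !S_INR. field; lra.
Qed.

(** The left side is nonincreasing in [k], since [(k+1)(k+2) <= (k + 3/2)^2 <= (x+k+1)^2], and it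
    starts at [1 / x^2 <= 4]. Squaring keeps the induction rational although the decay at [x = 1/2]
    is of order [k^(-1/2)]. *)
Lemma V_sqr_bound (x : R) (k : nat) : 1 / 2 <= x -> V x k ^ 2 * (INR k + 1) <= 4.
Proof.
  intros Hx; induction k as [|k IH].
  - simpl. assert (/ x <= 2).
    { apply Rmult_le_reg_l with x; [lra|]. rewrite Rinv_r; lra. }
    assert (0 < / x) by (apply Rinv_0_lt_compat; lra). nra.
  - pose proof (pos_INR k). pose proof (V_pos x k ltac:(lra)).
    apply Rle_trans with (2 := IH). cbn [V]. rewrite S_INR.
    replace ((V x k * ((INR k + 1) / (x + (INR k + 1)))) ^ 2 * (INR k + 1 + 1))
      with (V x k ^ 2 * (INR k + 1) *
            ((INR k + 1) * (INR k + 2) / (x + INR k + 1) ^ 2)) by (field; lra).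
    rewrite <- (Rmult_1_r (V x k ^ 2 * (INR k + 1))) at 2.
    apply Rmult_le_compat_l; [nra|].
    apply Rle_div_l; [nra|]. nra.
Qed.

Lemma V_bound (x : R) (k : nat) : 1 / 2 <= x -> V x k <= 2 * / sqrt (INR k + 1).
Proof.
  intros Hx. pose proof (pos_INR k). pose proof (V_pos x k ltac:(lra)).
  assert (Hs : 0 < sqrt (INR k + 1)) by (apply sqrt_lt_R0; lra).
  apply Rle_div_r; [exact Hs|].
  apply Rsqr_incr_0_var; [|lra].
  rewrite Rsqr_mult, Rsqr_sqrt by lra.
  pose proof (V_sqr_bound x k Hx). unfold Rsqr. lra.
Qed.

Lemma H_bound (x : R) (k : nat) : 1 / 2 <= x -> H x k <= 2 + 2 * ln (INR k + 1).
Proof.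
  intros Hx; induction k as [|k IH].
  - simpl. rewrite Rplus_0_l, ln_1.
    apply Rmult_le_reg_l with x; [lra|]. rewrite Rinv_r; lra.
  - pose proof (pos_INR k). cbn [H]. rewrite S_INR.
    (* [ln q <= q - 1] for this [q] reads [1/(k+2) <= ln (k+2) - ln (k+1)]; twice this increment
       dominates the new term of [H]. *)
    set (q := (INR k + 1) / (INR k + 1 + 1)).
    assert (Hq : 0 < q) by (apply Rdiv_lt_0_compat; lra).
    assert (Hl : ln q <= q - 1).
    { pose proof (exp_ineq1_le (ln q)) as He. rewrite exp_ln in He; lra. }
    unfold q in Hl at 1. rewrite ln_div in Hl by lra.
    assert (Hq' : q - 1 = - / (INR k + 2)) by (unfold q; field; lra).
    assert (/ (x + (INR k + 1)) <= 2 * / (INR k + 2)).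
    { replace (2 * / (INR k + 2)) with (/ ((INR k + 2) / 2)) by (field; lra).
      apply Rinv_le_contravar; lra. }
    lra.
Qed.

Lemma is_lim_seq_sqrt_shift : is_lim_seq (fun k => sqrt (INR k + 1)) p_infty.
Proof.
  refine (is_lim_comp_seq sqrt (fun k => INR k + 1) p_infty p_infty _ _ _).
  - exact filterlim_sqrt_p.
  - exists 0%nat; discriminate.
  - apply is_lim_seq_plus with p_infty 1;
      [apply is_lim_seq_INR|apply is_lim_seq_const|reflexivity].
Qed.

Lemma is_lim_seq_V (x : R) : 1 / 2 <= x -> is_lim_seq (V x) 0.
Proof.
  intros Hx.
  apply is_lim_seq_le_le with (fun _ => 0) (fun k => 2 * / sqrt (INR k + 1)).
  - intros k; split; [left; apply V_pos; lra|now apply V_bound].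
  - apply is_lim_seq_const.
  - replace (Finite 0) with (Finite (2 * 0)) by (f_equal; ring).
    apply is_lim_seq_mult'; [apply is_lim_seq_const|].
    apply (is_lim_seq_inv _ p_infty); [apply is_lim_seq_sqrt_shift|easy].
Qed.

(** [V_bound] and [H_bound] give order [ln k / sqrt k]. Rewriting with [s = sqrt (k + 1)] turns the
    bound into [4/s + 8 ln s / s], so that the limit of [ln y / y] applies. *)
Lemma is_lim_seq_VH (x : R) : 1 / 2 <= x -> is_lim_seq (fun k => V x k * H x k) 0.
Proof.
  intros Hx.
  apply is_lim_seq_le_le with (fun _ => 0)
    (fun k => 4 * / sqrt (INR k + 1) +
              8 * (ln (sqrt (INR k + 1)) / sqrt (INR k + 1))).
  - intros k. pose proof (pos_INR k).
    pose proof (V_pos x k ltac:(lra)). pose proof (H_pos x k ltac:(lra)).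
    assert (Hs : 0 < sqrt (INR k + 1)) by (apply sqrt_lt_R0; lra).
    split; [nra|].
    assert (Hl : ln (INR k + 1) = 2 * ln (sqrt (INR k + 1))).
    { rewrite <- (sqrt_sqrt (INR k + 1)) at 1 by lra. rewrite ln_mult by lra. ring. }
    pose proof (V_bound x k Hx). pose proof (H_bound x k Hx) as HH. rewrite Hl in HH.
    apply Rle_trans with (2 * / sqrt (INR k + 1) * (2 + 2 * (2 * ln (sqrt (INR k + 1))))).
    + apply Rmult_le_compat; lra.
    + right; field; lra.
  - apply is_lim_seq_const.
  - replace (Finite 0) with (Finite (4 * 0 + 8 * 0)) by (f_equal; ring).
    apply is_lim_seq_plus';
      (apply is_lim_seq_mult'; [apply is_lim_seq_const|]).
    + apply (is_lim_seq_inv _ p_infty); [apply is_lim_seq_sqrt_shift|easy].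
    + refine (is_lim_comp_seq (fun y => ln y / y) _ p_infty 0 _ _ _).
      * apply is_lim_div_ln_p.
      * exists 0%nat; discriminate.
      * apply is_lim_seq_sqrt_shift.
Qed.

(** Equality holds at [k = 0]. Afterwards [V] is multiplied by [(k+1)/(y+k+1) <= (k+1)/(k+3)], and
    the latter is exactly the ratio of consecutive telescoping differences [1/((k+1)(k+2))]. *)
Lemma V_decay (y : R) (k : nat) : 3 <= y ->
  V y k <= 2 / y * (/ (INR k + 1) - / (INR (S k) + 1)).
Proof.
  intros Hy; induction k as [|k IH].
  - simpl. right; field; lra.
  - pose proof (pos_INR k). cbn [V]. rewrite !S_INR in *.
    assert (Hr : (INR k + 1) / (y + (INR k + 1)) <= (INR k + 1) / (INR k + 3)).
    { apply Rmult_le_compat_l; [lra|]. apply Rinv_le_contravar; lra. }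
    apply Rle_trans with
      (2 / y * (/ (INR k + 1) - / (INR k + 1 + 1)) * ((INR k + 1) / (INR k + 3))).
    + apply Rmult_le_compat; try lra.
      * left; apply V_pos; lra.
      * left; apply Rdiv_lt_0_compat; lra.
    + right; field; lra.
Qed.

(** Each of the [k + 1] terms is at most [1 / y]. This linear bound is absorbed by the denominator
    [k + 1] in the weighted series. *)
Lemma H_le (y : R) (k : nat) : 0 < y -> H y k <= (INR k + 1) / y.
Proof.
  intros Hy; induction k as [|k IH].
  - simpl. right; field; lra.
  - pose proof (pos_INR k). cbn [H]. rewrite S_INR.
    assert (/ (y + (INR k + 1)) <= / y) by (apply Rinv_le_contravar; lra).
    replace ((INR k + 1 + 1) / y) with ((INR k + 1) / y + / y) by (field; lra). lra.
Qed.

(** * Series with weight [1/(k+1)] as sums of inverse squares and cubes *)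

Lemma inverse_square_series (x : R) : 1 / 2 <= x ->
  exists l : R, is_series (fun k => V x k / (INR k + 1)) l /\
            is_series (fun j => / (x + INR j) ^ 2) l.
Proof.
  intros Hx.
  (* Passing from [y] to [y + 1] lowers the term by [V y k / (y+k+1)], which by [V_step] is the
     difference of [V y k / y]; its value at [k = 0] is [1 / y^2]. *)
  destruct (is_series_shift_recursion (fun y k => V y k / (INR k + 1))
              (fun y k => V y k / y) x) as [l [Hl Hl']].
  - exact Hx.
  - intros y k Hy. pose proof (pos_INR k).
    replace (V y k / y - V y (S k) / y) with ((V y k - V y (S k)) / y) by (field; lra).
    rewrite V_step, V_shift by lra. field; lra.
  - intros y Hy. unfold Rdiv.
    replace (Finite 0) with (Finite (0 * / y)) by (f_equal; ring).
    apply is_lim_seq_mult'; [now apply is_lim_seq_V|apply is_lim_seq_const].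
  - intros y k Hy. pose proof (pos_INR k). pose proof (V_pos y k ltac:(lra)).
    split; [left; apply Rdiv_lt_0_compat; lra|].
    apply Rle_trans with (2 := V_decay y k Hy).
    apply Rle_div_l; [lra|]. nra.
  - exists l; split; [exact Hl|].
    apply is_series_ext with (2 := Hl').
    intros j; pose proof (pos_INR j); simpl; field; lra.
Qed.

Lemma inverse_cube_series (x : R) : 1 / 2 <= x ->
  exists l : R, is_series (fun k => V x k * H x k / (INR k + 1)) (2 * l) /\
            is_series (fun j => / (x + INR j) ^ 3) l.
Proof.
  intros Hx.
  (* Both functions are minus the [y]-derivatives of those used for inverse squares. At [k = 0] the
     second one equals [2 / y^3], which is where the factor 2 in the statement comes from. *)
  destruct (is_series_shift_recursion (fun y k => V y k * H y k / (INR k + 1))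
              (fun y k => V y k * H y k / y + V y k / y ^ 2) x) as [l [Hl Hl']].
  - exact Hx.
  - intros y k Hy. pose proof (pos_INR k).
    rewrite V_shift, H_shift by lra. cbn [V H]. rewrite S_INR. field; lra.
  - intros y Hy. unfold Rdiv.
    replace (Finite 0) with (Finite (0 * / y + 0 * / y ^ 2)) by (f_equal; ring).
    apply is_lim_seq_plus';
      (apply is_lim_seq_mult'; [|apply is_lim_seq_const]).
    + now apply is_lim_seq_VH.
    + now apply is_lim_seq_V.
  - intros y k Hy. pose proof (pos_INR k). pose proof (V_pos y k ltac:(lra)).
    pose proof (H_pos y k ltac:(lra)). pose proof (H_le y k ltac:(lra)) as HH.
    split; [left; apply Rdiv_lt_0_compat; nra|].
    apply Rle_trans with (2 := V_decay y k Hy).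
    apply Rle_div_l; [lra|].
    apply Rmult_le_compat_l; [lra|].
    apply Rle_trans with (1 := HH). apply Rle_div_l; nra.
  - exists (/ 2 * l); split; [replace (2 * (/ 2 * l)) with l by field; exact Hl|].
    apply is_series_ext with (fun j => / 2 * (V (x + INR j) 0 * H (x + INR j) 0 / (x + INR j) + V (x + INR j) 0 / (x + INR j) ^ 2)).
    + intros j; pose proof (pos_INR j); simpl; field; lra.
    + apply (is_series_scal (/ 2)) in Hl'. exact Hl'.
Qed.

(** * Reduction of the weight [1/((k+2)(k+3))] to [1/(k+1)] *)

Lemma telescoping_series (x P : R) : 1 / 2 <= x ->
  is_series (fun k => V x k / (INR k + 1)) P ->
  is_series (fun k => V x k / ((INR k + 2) * (INR k + 3)))
    (- (x * (x - 1) / 2) * P + (x - 1 / 2) / 2).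
Proof.
  intros Hx HP.
  (* [r] solves [r k - (k+1)/(x+k+1) * r (k+1) = 1/((k+2)(k+3)) + x(x-1)/2 * 1/(k+1)], the
     telescoping condition divided by [V x k]. It stays bounded, so [V x k * r k] tends to 0. *)
  set (r := fun k => (x - 1) / 2 + x * (x - 1) / 2 * / (INR k + 1)
                     + (1 - x / 2) * / (INR k + 2)).
  replace ((x - 1 / 2) / 2) with (V x 0 * r 0%nat)
    by (unfold r; simpl; field; lra).
  apply is_series_diff with (b := fun k => - (x * (x - 1) / 2) * (V x k / (INR k + 1)))
                            (D := fun k => V x k * r k).
  - intros k. pose proof (pos_INR k). unfold r; cbn [V]; rewrite !S_INR. field; lra.
  - replace (Finite 0) with
      (Finite (0 * ((x - 1) / 2 + x * (x - 1) / 2 * 0 + (1 - x / 2) * 0)))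
      by (f_equal; ring).
    apply is_lim_seq_mult'; [now apply is_lim_seq_V|].
    repeat apply is_lim_seq_plus';
      try apply is_lim_seq_mult'; try apply is_lim_seq_const;
      apply is_lim_seq_inv_shift.
  - exact (is_series_scal _ _ _ HP).
Qed.

(* Minus the [x]-derivative of the identity of [telescoping_series], term by term. *)
Lemma telescoping_series_H (x P Q : R) : 1 / 2 <= x ->
  is_series (fun k => V x k / (INR k + 1)) P ->
  is_series (fun k => V x k * H x k / (INR k + 1)) Q ->
  is_series (fun k => V x k * H x k / ((INR k + 2) * (INR k + 3)))
    ((x - 1 / 2) * P - x * (x - 1) / 2 * Q - 1 / 2).
Proof.
  intros Hx HP HQ.
  set (r := fun k => (x - 1) / 2 + x * (x - 1) / 2 * / (INR k + 1)
                     + (1 - x / 2) * / (INR k + 2)).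
  (* [r'] is the [x]-derivative of [r], so [V * H * r - V * r'] is minus the derivative of
     [V * r]. *)
  set (r' := fun k => 1 / 2 + (x - 1 / 2) * / (INR k + 1) + (- (1 / 2)) * / (INR k + 2)).
  replace ((x - 1 / 2) * P - x * (x - 1) / 2 * Q - 1 / 2) with
    (((x - 1 / 2) * P + - (x * (x - 1) / 2) * Q) +
     (V x 0 * H x 0 * r 0%nat - V x 0 * r' 0%nat))
    by (unfold r, r'; simpl; field; lra).
  apply is_series_diff with
    (b := fun k => (x - 1 / 2) * (V x k / (INR k + 1)) +
                   - (x * (x - 1) / 2) * (V x k * H x k / (INR k + 1)))
    (D := fun k => V x k * H x k * r k - V x k * r' k).
  - intros k. pose proof (pos_INR k).
    unfold r, r'; cbn [V H]; rewrite !S_INR. field; lra.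
  - replace (Finite 0) with
      (Finite (0 * ((x - 1) / 2 + x * (x - 1) / 2 * 0 + (1 - x / 2) * 0)
             - 0 * (1 / 2 + (x - 1 / 2) * 0 + (- (1 / 2)) * 0)))
      by (f_equal; ring).
    apply is_lim_seq_minus'; apply is_lim_seq_mult';
      [now apply is_lim_seq_VH| |now apply is_lim_seq_V|];
      repeat apply is_lim_seq_plus';
      try apply is_lim_seq_mult'; try apply is_lim_seq_const;
      apply is_lim_seq_inv_shift.
  - apply (is_series_plus _ _ _ _
      (is_series_scal (x - 1 / 2) _ _ HP)
      (is_series_scal (- (x * (x - 1) / 2)) _ _ HQ)).
Qed.

(** * Half-integer power sums in terms of zeta values *)

Lemma is_series_tail (a : nat -> R) (l : R) (M : nat) :
  is_series a l -> is_series (fun k => a (M + k)%nat) (l - psum a M).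
Proof.
  intros Hl. apply is_series_psum. apply is_series_psum in Hl.
  apply is_lim_seq_ext with (fun N => psum a (N + M) - psum a M).
  - intros N. rewrite Nat.add_comm, psum_app. ring.
  - apply is_lim_seq_minus'; [|apply is_lim_seq_const].
    apply (is_lim_seq_incr_n (psum a)), Hl.
Qed.

(** Splitting the first [2N] terms of the zeta series by parity and scaling by [2^p] leaves the
    half-integer sum plus the first [N] zeta terms. The convergence hypothesis makes the total
    [Series] inside [zeta] a genuine sum. *)
Lemma is_series_half_integers (p : nat) :
  ex_series (fun j => / (1 + INR j) ^ p) ->
  is_series (fun j => / (1 / 2 + INR j) ^ p) ((2 ^ p - 1) * zeta (INR p)).
Proof.
  intros He.
  assert (Hz : is_series (fun j => / (1 + INR j) ^ p) (zeta (INR p))).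
  { replace (zeta (INR p)) with (Series (fun j => / (1 + INR j) ^ p)).
    - now apply Series_correct.
    - apply Series_ext; intros k.
      rewrite Rpower_pow by (apply lt_0_INR; lia). rewrite S_INR, Rplus_comm; reflexivity. }
  apply is_series_psum in Hz. apply is_series_psum.
  apply is_lim_seq_ext with
    (fun N => 2 ^ p * psum (fun j => / (1 + INR j) ^ p) (2 * N)
              - psum (fun j => / (1 + INR j) ^ p) N).
  - intros N.
    rewrite psum_even_odd, Rmult_plus_distr_l, <- !psum_scal.
    rewrite (psum_ext (fun k => 2 ^ p * / (1 + INR (S (2 * k))) ^ p)
                      (fun k => / (1 + INR k) ^ p)).
    + rewrite Rplus_minus_r. apply psum_ext; intros k _. pose proof (pos_INR k).
      rewrite mult_INR. change (INR 2) with 2.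
      replace (1 + 2 * INR k) with (2 * (1 / 2 + INR k)) by field.
      rewrite Rpow_mult_distr. field. split; apply pow_nonzero; lra.
    + intros k _. pose proof (pos_INR k).
      rewrite S_INR, mult_INR. change (INR 2) with 2.
      replace (1 + (2 * INR k + 1)) with (2 * (1 + INR k)) by ring.
      rewrite Rpow_mult_distr. field. split; apply pow_nonzero; lra.
  - replace (Finite ((2 ^ p - 1) * zeta (INR p)))
      with (Finite (2 ^ p * zeta (INR p) - zeta (INR p))) by (f_equal; ring).
    apply is_lim_seq_minus'; [|exact Hz].
    apply is_lim_seq_mult'; [apply is_lim_seq_const|].
    apply (is_lim_seq_subseq (psum (fun j => / (1 + INR j) ^ p)) _ (fun N => (2 * N)%nat)).
    + apply eventually_subseq; intros n; lia.
    + exact Hz.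
Qed.

(** * The sum of inverse squares of half-integers, by cosecant sums *)

Lemma mul_cos_le_sin (t : R) : 0 <= t <= PI -> t * cos t <= sin t.
Proof.
  intros Ht.
  (* The derivative [u * sin u] of [sin u - u * cos u] is nonnegative on [[0, PI]]. *)
  destruct (MVT_gen (fun u => sin u - u * cos u) 0 t (fun u => u * sin u))
    as [c [Hc Heq]].
  - intros u _. auto_derive; [trivial|ring].
  - intros u _. apply continuity_pt_minus; [apply continuity_sin|].
    apply continuity_pt_mult; [apply continuity_pt_id|apply continuity_cos].
  - rewrite Rmin_left, Rmax_right in Hc by lra.
    rewrite sin_0, cos_0 in Heq.
    assert (0 <= sin c) by (apply sin_ge_0; lra).
    assert (0 <= c * sin c * (t - 0)) by (apply Rmult_le_pos; [nra|lra]).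
    lra.
Qed.

(** The lower bound is [cot t <= 1 / t] squared, as [cot^2 = 1/sin^2 - 1]; the upper one is
    [sin t < t]. *)
Lemma inv_sqr_bounds (t : R) : 0 < t < PI / 2 ->
  / sin t ^ 2 - 1 <= / t ^ 2 <= / sin t ^ 2.
Proof.
  intros Ht.
  assert (Hs : 0 < sin t) by (apply sin_gt_0; lra).
  assert (Hc : 0 < cos t) by (apply cos_gt_0; lra).
  pose proof (sin_lt_x t ltac:(lra)) as H1.
  pose proof (mul_cos_le_sin t ltac:(lra)) as H2.
  split.
  - replace (/ sin t ^ 2 - 1) with ((cos t / sin t) ^ 2).
    + rewrite <- pow_inv. apply pow_incr. split.
      * left; now apply Rdiv_lt_0_compat.
      * apply Rle_div_l; [lra|]. apply Rmult_le_reg_l with t; [lra|].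
        replace (t * (/ t * sin t)) with (sin t) by (field; lra). lra.
    + pose proof (sin2_cos2 t) as Hsc. unfold Rsqr in Hsc.
      field_simplify_eq; [|lra]. nra.
  - apply Rinv_le_contravar; [nra|]. apply pow_incr; lra.
Qed.

(** Doubling the number of terms pairs the angle [t] with [PI/2 - t], and
    [1/sin^2 t + 1/cos^2 t = 4/sin^2 (2t)] reduces each pair to a term of the previous sum.
    Reversing the second half aligns the pairs. *)
Lemma csc_sqr_sum (n : nat) :
  psum (fun k => / sin ((1 / 2 + INR k) * (PI / (2 * 2 ^ n))) ^ 2) (2 ^ n)
  = 2 * (2 ^ n) ^ 2.
Proof.
  pose proof PI_RGT_0 as Hpi.
  induction n as [|n IH].
  - simpl.
    replace ((1 / 2 + 0) * (PI / (2 * 1))) with (PI / 4) by field.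
    rewrite sin_PI4.
    assert (Hs : sqrt 2 * sqrt 2 = 2) by (apply sqrt_sqrt; lra).
    assert (sqrt 2 <> 0) by (intros E; rewrite E in Hs; lra).
    field_simplify_eq; [|assumption]. simpl; lra.
  - set (N := (2 ^ n)%nat) in *.
    assert (HN : 0 < 2 ^ n) by (apply pow_lt; lra).
    assert (HNR : INR N = 2 ^ n) by (unfold N; rewrite pow_INR; reflexivity).
    replace (2 ^ S n)%nat with (N + N)%nat by (simpl; lia).
    rewrite psum_app, <- (psum_rev (fun k => / sin ((1 / 2 + INR (N + k)) * _) ^ 2)).
    rewrite <- psum_plus.
    replace (2 * (2 ^ S n) ^ 2) with (4 * (2 * (2 ^ n) ^ 2)) by (simpl; ring).
    rewrite <- IH, <- psum_scal.
    apply psum_ext; intros k Hk. pose proof (pos_INR k) as Hk0.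
    set (t := (1 / 2 + INR k) * (PI / (2 * 2 ^ S n))).
    replace ((1 / 2 + INR (N + (N - 1 - k))) * (PI / (2 * 2 ^ S n)))
      with (PI / 2 - t).
    + replace ((1 / 2 + INR k) * (PI / (2 * 2 ^ n))) with (2 * t)
        by (unfold t; simpl; field; lra).
      assert (Ht : 0 < t < PI / 2).
      { apply (le_INR (S k)) in Hk. rewrite S_INR, HNR in Hk. unfold t.
        replace ((1 / 2 + INR k) * (PI / (2 * 2 ^ S n)))
          with ((1 / 2 + INR k) / (2 * 2 ^ n) * (PI / 2)) by (simpl; field; lra).
        assert (0 < (1 / 2 + INR k) / (2 * 2 ^ n) < 1).
        { split; [apply Rdiv_lt_0_compat; lra|apply Rlt_div_l; lra]. }
        split; nra. }
      assert (Hs : 0 < sin t) by (apply sin_gt_0; lra).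
      assert (Hc : 0 < cos t) by (apply cos_gt_0; lra).
      rewrite sin_shift, sin_2a.
      pose proof (sin2_cos2 t) as Hsc. unfold Rsqr in Hsc.
      field_simplify_eq; [|lra]. nra.
    + unfold t. rewrite plus_INR, !minus_INR, HNR by lia. simpl. field. lra.
Qed.

Lemma basel_half_integers : is_series (fun j => / (1 / 2 + INR j) ^ 2) (PI ^ 2 / 2).
Proof.
  (* Convergence is already known, so the limit may be computed along [N = 2^n] alone. *)
  destruct (inverse_square_series (1 / 2) (Rle_refl _)) as [l [_ Hl]].
  replace (PI ^ 2 / 2) with l; [exact Hl|].
  apply is_series_psum in Hl.
  pose proof PI_RGT_0 as Hpi.
  assert (Hgeom : is_lim_seq (fun n => (1 / 2) ^ n) 0).
  { apply is_lim_seq_geom. rewrite Rabs_pos_eq; lra. }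
  assert (Hsub : is_lim_seq (fun n => psum (fun j => / (1 / 2 + INR j) ^ 2) (2 ^ n)) l).
  { apply (is_lim_seq_subseq (psum (fun j => / (1 / 2 + INR j) ^ 2)) _ (fun n => (2 ^ n)%nat)).
    - apply eventually_subseq; intros n. simpl.
      pose proof (Nat.pow_nonzero 2 n). lia.
    - exact Hl. }
  apply is_lim_seq_unique in Hsub.
  assert (Hlim : is_lim_seq (fun n => psum (fun j => / (1 / 2 + INR j) ^ 2) (2 ^ n)) (PI ^ 2 / 2)).
  { apply is_lim_seq_le_le with
      (* Each of the [N] terms loses at most 1 before scaling by [PI^2 / (4 N^2)], a total error of
         at most [PI^2 / (4N)]. *)
      (fun n => PI ^ 2 / 2 - PI ^ 2 / 4 * (1 / 2) ^ n) (fun _ => PI ^ 2 / 2).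
    - intros n. set (N := (2 ^ n)%nat).
      assert (HN : 0 < 2 ^ n) by (apply pow_lt; lra).
      assert (HNR : INR N = 2 ^ n) by (unfold N; rewrite pow_INR; reflexivity).
      assert (Hb : forall k, (k < N)%nat ->
        / sin ((1 / 2 + INR k) * (PI / (2 * 2 ^ n))) ^ 2 + - (1) <=
        (4 * (2 ^ n) ^ 2 / PI ^ 2) * / (1 / 2 + INR k) ^ 2 <=
        / sin ((1 / 2 + INR k) * (PI / (2 * 2 ^ n))) ^ 2).
      { intros k Hk. pose proof (pos_INR k) as Hk0.
        apply (le_INR (S k)) in Hk. rewrite S_INR, HNR in Hk.
        set (t := (1 / 2 + INR k) * (PI / (2 * 2 ^ n))).
        replace (4 * (2 ^ n) ^ 2 / PI ^ 2 * / (1 / 2 + INR k) ^ 2) with (/ t ^ 2)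
          by (unfold t; field; lra).
        apply inv_sqr_bounds. unfold t.
        replace ((1 / 2 + INR k) * (PI / (2 * 2 ^ n)))
          with ((1 / 2 + INR k) / 2 ^ n * (PI / 2)) by (field; lra).
        assert (0 < (1 / 2 + INR k) / 2 ^ n < 1).
        { split; [apply Rdiv_lt_0_compat; lra|apply Rlt_div_l; lra]. }
        split; nra. }
      pose proof (psum_le _ _ N (fun k Hk => proj1 (Hb k Hk))) as Hlo.
      pose proof (psum_le _ _ N (fun k Hk => proj2 (Hb k Hk))) as Hhi.
      rewrite psum_plus, psum_const, HNR, psum_scal in Hlo.
      rewrite psum_scal in Hhi. unfold N in Hlo, Hhi. rewrite csc_sqr_sum in Hlo, Hhi.
      fold N in Hlo, Hhi. set (S := psum _ N) in *.
      assert (Hg : (1 / 2) ^ n = / 2 ^ n).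
      { unfold Rdiv. rewrite Rmult_1_l, pow_inv. reflexivity. }
      rewrite Hg.
      assert (Hpos : 0 < PI ^ 2 / (4 * (2 ^ n) ^ 2)) by (apply Rdiv_lt_0_compat; nra).
      split.
      + apply (Rmult_le_compat_l _ _ _ (Rlt_le _ _ Hpos)) in Hlo.
        replace S with (PI ^ 2 / (4 * (2 ^ n) ^ 2) * (4 * (2 ^ n) ^ 2 / PI ^ 2 * S))
          by (field; lra).
        apply Rle_trans with (2 := Hlo). right; field; lra.
      + apply (Rmult_le_compat_l _ _ _ (Rlt_le _ _ Hpos)) in Hhi.
        replace S with (PI ^ 2 / (4 * (2 ^ n) ^ 2) * (4 * (2 ^ n) ^ 2 / PI ^ 2 * S))
          by (field; lra).
        apply Rle_trans with (1 := Hhi). right; field; lra.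
    - replace (Finite (PI ^ 2 / 2)) with (Finite (PI ^ 2 / 2 - PI ^ 2 / 4 * 0))
        by (f_equal; ring).
      apply is_lim_seq_minus'; [apply is_lim_seq_const|].
      apply is_lim_seq_mult'; [apply is_lim_seq_const|exact Hgeom].
    - apply is_lim_seq_const. }
  apply is_lim_seq_unique in Hlim. congruence.
Qed.

(** * Odd harmonic numbers and binomial quotients through [H] and [V] *)

Lemma odd_harmonic_psum (r m : nat) :
  odd_harmonic r m = psum (fun k => / (2 * INR k + 1) ^ r) m.
Proof.
  unfold odd_harmonic. induction m as [|m IH].
  - rewrite sum_n_m_zero; [reflexivity|lia].
  - rewrite sum_n_Sm by lia. rewrite IH. cbn [psum]. rewrite S_INR.
    change plus with Rplus. f_equal. f_equal. f_equal. ring.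
Qed.

Lemma psum_half_integers (r m : nat) :
  psum (fun k => / (1 / 2 + INR k) ^ r) m = 2 ^ r * odd_harmonic r m.
Proof.
  rewrite odd_harmonic_psum, <- psum_scal. apply psum_ext; intros k _.
  pose proof (pos_INR k).
  replace (2 * INR k + 1) with (2 * (1 / 2 + INR k)) by field.
  rewrite Rpow_mult_distr. field. split; apply pow_nonzero; lra.
Qed.

(** With [x = m + 1/2], each added term [1/(2(m+j)+1)] is half of [1/(x+j)], for [j] from 0 to
    [k]. *)
Lemma odd_harmonic_add (m k : nat) :
  odd_harmonic 1 (S k + m) = odd_harmonic 1 m + H (INR m + 1 / 2) k / 2.
Proof.
  rewrite !odd_harmonic_psum. pose proof (pos_INR m).
  induction k as [|k IH].
  - simpl. field. lra.
  - change (S (S k) + m)%nat with (S (S k + m)). cbn [psum]. rewrite IH.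
    pose proof (pos_INR k). cbn [H].
    rewrite plus_INR, !S_INR. field. lra.
Qed.

Lemma binom_neq_0 (n k : nat) : binom n k <> 0.
Proof.
  unfold binom, Binomial.C. apply Rgt_not_eq, Rdiv_lt_0_compat.
  - apply INR_fact_lt_0.
  - apply Rmult_lt_0_compat; apply INR_fact_lt_0.
Qed.

Lemma binom_central_mul (m n : nat) :
  binom (2 * (n + m)) (n + m) * binom (n + m) m =
  INR (fact (2 * (n + m))) / (INR (fact (n + m)) * INR (fact m) * INR (fact n)).
Proof.
  unfold binom, Binomial.C.
  replace (2 * (n + m) - (n + m))%nat with (n + m)%nat by lia.
  replace (n + m - m)%nat with n by lia.
  field. repeat split; apply INR_fact_neq_0.
Qed.

(** Raising [n] by one multiplies the left side by [(n+1)/(m + 1/2 + n)], which is also the ratio of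
    consecutive values of [n * V x (n-1)]. The base case applies this ratio at [n = 0]. *)
Lemma binom_V (m k : nat) :
  2 ^ (2 * S k) / (binom (2 * (S k + m)) (S k + m) * binom (S k + m) m) =
  / binom (2 * m) m * (INR (S k) * V (INR m + 1 / 2) k).
Proof.
  assert (Hstep : forall n,
    2 ^ (2 * S n) / (binom (2 * (S n + m)) (S n + m) * binom (S n + m) m) =
    2 ^ (2 * n) / (binom (2 * (n + m)) (n + m) * binom (n + m) m) *
    (INR (S n) / (INR m + 1 / 2 + INR n))).
  { intros n. rewrite !binom_central_mul.
    replace (2 * (S n + m))%nat with (S (S (2 * (n + m)))) by lia.
    replace (S n + m)%nat with (S (n + m)) by lia.
    replace (2 * S n)%nat with (S (S (2 * n))) by lia.
    pose proof (pos_INR n). pose proof (pos_INR m).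
    rewrite !fact_simpl, !mult_INR, !S_INR, !mult_INR, !plus_INR.
    cbn [pow]. simpl (INR 2).
    field. repeat split; try apply INR_fact_neq_0; try lra. }
  pose proof (pos_INR m).
  induction k as [|k IH].
  - rewrite Hstep.
    assert (H1 : binom (0 + m) m = 1).
    { unfold binom, Binomial.C. simpl. rewrite Nat.sub_diag. simpl.
      field. apply INR_fact_neq_0. }
    rewrite H1. simpl. field. split; [lra|apply binom_neq_0].
  - rewrite Hstep, IH. cbn [V]. pose proof (pos_INR k).
    rewrite !S_INR. field. split; [lra|apply binom_neq_0].
Qed.

(** * Evaluation for general [m] and the two special cases *)

Lemma shifted_series (m : nat) :
    is_series_from_1
      (fun n : nat =>
         2 ^ (2 * n) * odd_harmonic 1 (n + m) /
         (INR n * (INR n + 1) * (INR n + 2) *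
          binom (2 * (n + m)) (n + m) * binom (n + m) m))
      (1 / (2 * binom (2 * m) m) *
         (INR m - odd_harmonic 1 m * (INR m - 1 / 2) * (INR m + 1 / 2)) *
         (3 * zeta 2 - 4 * odd_harmonic 2 m)
       - 1 / (2 * binom (2 * m) m) *
         ((INR m - 1 / 2) * (INR m + 1 / 2) *
            (7 * zeta 3 - 8 * odd_harmonic 3 m)
          - INR m * odd_harmonic 1 m + 1 / 2)).
Proof.
  pose proof (pos_INR m) as Hm.
  set (x := INR m + 1 / 2). assert (Hx : 1 / 2 <= x) by (unfold x; lra).
  (* Since [x = m + 1/2], the series over [x + j] is the half-integer series without its first [m]
     terms. *)
  assert (Hzeta : forall p l, ex_series (fun j => / (1 + INR j) ^ p) ->
    is_series (fun j => / (x + INR j) ^ p) l ->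
    l = (2 ^ p - 1) * zeta (INR p) - 2 ^ p * odd_harmonic p m).
  { intros p l He Hl.
    pose proof (is_series_tail _ _ m (is_series_half_integers p He)) as Ht.
    rewrite psum_half_integers in Ht.
    apply is_series_unique in Hl. apply is_series_unique in Ht.
    rewrite <- Hl, <- Ht. apply Series_ext; intros k.
    unfold x. rewrite plus_INR. f_equal. f_equal. ring. }
  destruct (inverse_square_series x Hx) as [P [HP HP']].
  destruct (inverse_cube_series x Hx) as [Q [HQ HQ']].
  apply Hzeta in HP';
    [|destruct (inverse_square_series 1) as [l [_ Hl]]; [lra|now exists l]].
  apply Hzeta in HQ';
    [|destruct (inverse_cube_series 1) as [l [_ Hl]]; [lra|now exists l]].
  replace (INR 2) with 2 in HP' by (simpl; ring).
  replace (INR 3) with 3 in HQ' by (simpl; ring).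
  pose proof (telescoping_series x P Hx HP) as HF.
  pose proof (telescoping_series_H x P (2 * Q) Hx HP HQ) as HG.
  set (b := binom (2 * m) m).
  assert (Hb : b <> 0) by apply binom_neq_0.
  (* The weights come from [O_(n+m) = O_m + H x k / 2] with [n = k + 1], over the common factor
     [1 / b]. *)
  pose proof (is_series_plus _ _ _ _
    (is_series_scal (odd_harmonic 1 m / b) _ _ HF)
    (is_series_scal (1 / (2 * b)) _ _ HG)) as Hsum.
  match type of Hsum with is_series _ ?l => replace (_ - _) with l end.
  - apply is_series_ext with (2 := Hsum). intros k.
    change plus with Rplus; change scal with Rmult. cbv beta.
    match goal with |- ?u = ?v => change (@eq R u v) end.
    pose proof (pos_INR k).
    rewrite odd_harmonic_add.
    transitivity (2 ^ (2 * S k) / (binom (2 * (S k + m)) (S k + m) * binom (S k + m) m) *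
      ((odd_harmonic 1 m + H x k / 2) / (INR (S k) * (INR (S k) + 1) * (INR (S k) + 2)))).
    + rewrite binom_V. fold b x. rewrite S_INR. field. lra.
    + fold x. rewrite S_INR. field.
      repeat split; try lra; apply binom_neq_0.
  - change plus with Rplus; change scal with Rmult. cbv beta.
    match goal with |- ?u = ?v => change (@eq R u v) end.
    (* Here [x(x-1) = (m - 1/2)(m + 1/2)] and [x - 1/2 = m]. *)
    rewrite HP', HQ'. unfold x. field. exact Hb.
Qed.

Theorem theorem12 :
  (forall m : nat,
    is_series_from_1
      (fun n : nat =>
         2 ^ (2 * n) * odd_harmonic 1 (n + m) /
         (INR n * (INR n + 1) * (INR n + 2) *
          binom (2 * (n + m)) (n + m) * binom (n + m) m))
      (1 / (2 * binom (2 * m) m) *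
         (INR m - odd_harmonic 1 m * (INR m - 1 / 2) * (INR m + 1 / 2)) *
         (3 * zeta 2 - 4 * odd_harmonic 2 m)
       - 1 / (2 * binom (2 * m) m) *
         ((INR m - 1 / 2) * (INR m + 1 / 2) *
            (7 * zeta 3 - 8 * odd_harmonic 3 m)
          - INR m * odd_harmonic 1 m + 1 / 2)))
  /\
  is_series_from_1
    (fun n : nat =>
       2 ^ (2 * n) * odd_harmonic 1 n /
       (INR n * (INR n + 1) * (INR n + 2) * binom (2 * n) n))
    (7 / 8 * zeta 3 - 1 / 4)
  /\
  is_series_from_1
    (fun n : nat =>
       2 ^ (2 * n) * odd_harmonic 1 (n + 1) /
       (INR n * (INR n + 1) ^ 2 * (INR n + 2) *
        binom (2 * (n + 1)) (n + 1)))
    (PI ^ 2 / 32 - 21 / 16 * zeta 3 + 11 / 8).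
Proof.
  repeat split; [exact shifted_series| |].
  (* At [m = 0] the coefficient of [zeta 2] vanishes. *)
  - pose proof (shifted_series 0) as H0.
    assert (Hb : forall n, binom n 0 = 1).
    { intros n. unfold binom, Binomial.C. rewrite Nat.sub_0_r. simpl.
      field. apply INR_fact_neq_0. }
    assert (HO : forall r, odd_harmonic r 0 = 0)
      by (intros r; apply odd_harmonic_psum).
    rewrite Hb, !HO in H0. simpl (INR 0) in H0.
    unfold is_series_from_1 in *.
    match type of H0 with is_series _ ?l => replace (_ - _) with l by field end.
    apply is_series_ext with (2 := H0). intros k.
    rewrite Nat.add_0_r, Hb, Rmult_1_r. reflexivity.
  - pose proof (shifted_series 1) as H1.
    (* This binomial supplies the second factor [n + 1] of the squared denominator. *)
    assert (Hb : forall n, binom (n + 1) 1 = INR n + 1).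
    { intros n. unfold binom, Binomial.C.
      replace (n + 1 - 1)%nat with n by lia.
      rewrite Nat.add_1_r, fact_simpl, mult_INR, S_INR. simpl.
      field. apply INR_fact_neq_0. }
    assert (HO : forall r, odd_harmonic r 1 = 1).
    { intros r. rewrite odd_harmonic_psum. simpl.
      rewrite Rmult_0_r, !Rplus_0_l, pow1. apply Rinv_1. }
    (* The half-integer inverse squares are summed in two ways, through [zeta 2] and through
       [PI]. *)
    assert (Hz : 3 * zeta 2 = PI ^ 2 / 2).
    { pose proof basel_half_integers as Hpi.
      assert (Hs : is_series (fun j => / (1 / 2 + INR j) ^ 2)
                             ((2 ^ 2 - 1) * zeta (INR 2))).
      { apply is_series_half_integers.
        destruct (inverse_square_series 1) as [l [_ Hl]]; [lra|now exists l]. }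
      apply is_series_unique in Hs. apply is_series_unique in Hpi.
      rewrite Hpi in Hs. rewrite Hs. replace (INR 2) with 2 by (simpl; ring). ring. }
    change (2 * 1)%nat with (1 + 1)%nat in H1.
    rewrite (Hb 1%nat), !HO, Hz in H1. simpl (INR 1) in H1.
    unfold is_series_from_1 in *.
    match type of H1 with is_series _ ?l => replace (_ + _) with l by field end.
    apply is_series_ext with (2 := H1). intros k.
    rewrite Hb. pose proof (pos_INR (S k)).
    match goal with |- ?u = ?v => change (@eq R u v) end.
    field. pose proof (lt_0_INR (S k) ltac:(lia)).
    repeat split; try lra. apply binom_neq_0.
Qed.
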